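(* Let $a,b$ be integers with $1\leq b\leq a$. Then the full count matroid $\mathcal{M}(a,b)$ (on the edge set of $K_n^{a,b}$, for any positive integer $n$) has the $k$-fold circuit property for all $k\geq 1$.
   Context: For integers $a,b$ with $0\leq b<2a$ and a multigraph $H=(V,E)$ (loops allowed), the count matroid $\mathcal{M}_{a,b}(H)$ is the matroid on $E$ in which $F\subseteq E$ is independent iff $|F'|\leq a|V(F')|-b$ for every nonempty $F'\subseteq F$, where $V(F')$ is the set of vertices incident to edges of $F'$. $K_n^{a,b}$ is the multigraph on $n$ vertices in which each vertex has $\max\{a-b,0\}$ loops and each pair of distinct vertices is joined by $2a-b$ parallel edges; the full count matroid is $\mathcal{M}(a,b)=\mathcal{M}_{a,b}(K_n^{a,b})$. For a matroid $(E,r)$ with closure $\mathrm{cl}(X)=\{x:r(X+x)=r(X)\}$: a cyclic set is a set $D$ with $r(D-e)=r(D)$ for all $e\in D$; a $k$-fold circuit is a cyclic set with $r(D)=|D|-k$; its principal partition is $\{D\setminus B: B\subseteq D\text{ a }(k-1)\text{-fold circuit}\}$ (a partition of $D$). A $k$-fold circuit $D$ with principal partition $\{A_1,\dots,A_\ell\}$ is balanced if $r(\bigcap_{i=1}^\ell\mathrm{cl}(D\setminus A_i))=\ell-k$, and the matroid has the $k$-fold circuit property if all its $k$-fold circuits are balanced. *)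

(* Defs.v *)
From HB Require Import structures.
From mathcomp Require Import all_boot.

Set Implicit Arguments.
Unset Strict Implicit.
Unset Printing Implicit Defensive.

Record matroid (E : finType) := Matroid {
  indep : pred {set E};
  indep0 : indep set0;
  indepS : forall I J : {set E}, I \subset J -> indep J -> indep I;
  indep_aug : forall I J : {set E}, indep I -> indep J -> #|I| < #|J| ->
    exists2 e, e \in J :\: I & indep (e |: I)
}.

Section MatroidTheory.
Variables (E : finType) (M : matroid E).
Implicit Types (B D X : {set E}) (k : nat).

Definition rank X : nat := \max_(I : {set E} | (I \subset X) && indep M I) #|I|.

Definition cl X : {set E} := [set x | rank (x |: X) == rank X].

Definition cyclic_set D : bool := [forall e in D, rank (D :\ e) == rank D].

(* r(D) = |D| - k as integers, written without subtraction. *)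
Definition kfold_circuit k D : bool := cyclic_set D && (rank D + k == #|D|).

(* Meaningful for k > 0 only, because of the truncated predecessor. *)
Definition principal_partition k D : {set {set E}} :=
  [set D :\: B | B : {set E} & (B \subset D) && kfold_circuit k.-1 B].

(* The rank of the intersection equals l - k as an integer, where l is the
   number of parts. *)
Definition balanced k D : Prop :=
  rank (\bigcap_(A in principal_partition k D) cl (D :\: A)) + k
  = #|principal_partition k D|.

Definition kfold_circuit_property k : Prop :=
  forall D, kfold_circuit k D -> balanced k D.

End MatroidTheory.

(* An edge is a loop when it has exactly one end; parallel edges are distinct
   elements of [edge] with the same ends. *)
Record multigraph := Multigraph {
  vertex : finType;
  edge : finType;
  ends : edge -> {set vertex};
  card_ends : forall e, 0 < #|ends e| <= 2
}.

Section CountMatroid.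
Variables (a b : nat) (H : multigraph).
Implicit Types (F I J T : {set edge H}).

Definition vertices_of F : {set vertex H} := \bigcup_(e in F) ends e.

(* |F'| <= a |V(F')| - b as integers, written without subtraction. *)
Definition count_indep F : bool :=
  [forall F' : {set edge H}, (F' \subset F) && (F' != set0) ==>
     (#|F'| + b <= a * #|vertices_of F'|)].

Lemma count_indepP F :
  reflect (forall F', F' \subset F -> F' != set0 ->
             #|F'| + b <= a * #|vertices_of F'|)
          (count_indep F).
Proof.
apply: (iffP forallP) => [h F' s n | h F']; first by move: (h F'); rewrite s n.
by apply/implyP => /andP[s n]; apply: h.
Qed.

Lemma vertices_ofS F F' : F \subset F' -> vertices_of F \subset vertices_of F'.
Proof.
move=> s; apply/bigcupsP => e eF; apply: bigcup_sup; exact: (subsetP s).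
Qed.

Lemma vertices_ofU F F' :
  vertices_of (F :|: F') = vertices_of F :|: vertices_of F'.
Proof. exact: bigcup_setU. Qed.

Lemma count_indep0 : count_indep set0.
Proof. by apply/count_indepP => F'; rewrite subset0 => ->. Qed.

Lemma count_indepS I J : I \subset J -> count_indep J -> count_indep I.
Proof.
move=> s /count_indepP h; apply/count_indepP => F' sF; apply: h.
exact: subset_trans sF s.
Qed.

Definition tight I T :=
  [&& T \subset I, T != set0 & #|T| + b == a * #|vertices_of T|].

Lemma tightU I T T' : count_indep I -> tight I T -> tight I T' ->
  T :&: T' != set0 -> tight I (T :|: T').
Proof.
move=> /count_indepP hI /and3P[s n /eqP t] /and3P[s' n' /eqP t'] nI.
have sU : T :|: T' \subset I by rewrite subUset s s'.
have nU : T :|: T' != set0 by rewrite setU_eq0 negb_and n.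
rewrite /tight sU nU eqn_leq hI //=.
have hcap : #|T :&: T'| + b <= a * #|vertices_of (T :&: T')|.
  by apply: hI => //; apply: subset_trans s; apply: subsetIl.
have hv : #|vertices_of (T :&: T')| <= #|vertices_of T :&: vertices_of T'|.
  by apply: subset_leq_card; rewrite subsetI !vertices_ofS ?subsetIl ?subsetIr.
have := cardsUI T T'; have := cardsUI (vertices_of T) (vertices_of T').
rewrite -vertices_ofU => eV eE.
have hcap' := leq_trans hcap (leq_mul (leqnn a) hv).
rewrite -(leq_add2r (#|T :&: T'| + b)) addnACA eE.
rewrite addnACA t t' -mulnDr -eV mulnDr leq_add2l; exact: hcap'.
Qed.

Lemma tight_blocker I e : 0 < a -> count_indep I -> count_indep [set e] ->
  ~~ count_indep (e |: I) ->
  exists2 T, tight I T & ends e \subset vertices_of T.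
Proof.
move=> a0 /count_indepP hI /count_indepP he /forallPn[F].
rewrite negb_imply -ltnNge => /andP[/andP[sF nF] lF].
have eF : e \in F.
  apply: contraTT lF => eF; rewrite -leqNgt; apply: hI => //.
  apply/subsetP => x xF; have := subsetP sF x xF; rewrite in_setU1.
  by case/predU1P=> // ex; rewrite -ex xF in eF.
pose T := F :\ e.
have sT : T \subset I by rewrite subDset.
have nT : T != set0.
  apply: contraTneq lF => T0; have Fe : F = [set e].
    by rewrite -(setD1K eF) -/T T0 setU0.
  by rewrite -leqNgt Fe; apply: he => //; rewrite -Fe.
have hT := hI T sT nT.
have cF : #|F| = #|T|.+1 by rewrite (cardsD1 e) eF.
have sV : vertices_of T \subset vertices_of F by apply: vertices_ofS; rewrite subD1set.
have cV := subset_leq_card sV.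
have lT : a * #|vertices_of F| <= #|T| + b by move: lF; rewrite cF addSn ltnS.
have eV : vertices_of T = vertices_of F.
  apply/eqP; rewrite eqEcard sV -(leq_pmul2l a0) /=; exact: leq_trans lT hT.
exists T; last by rewrite eV; apply: bigcup_sup.
by rewrite /tight sT nT eqn_leq hT eV.
Qed.

Lemma count_indep_aug I J : count_indep I -> count_indep J -> #|I| < #|J| ->
  exists2 e, e \in J :\: I & count_indep (e |: I).
Proof.
move=> hI hJ ltIJ.
have a0 : 0 < a.
  case: (posnP a) hJ => // a0 /count_indepP hJ.
  have J0 : J != set0 by rewrite -card_gt0; apply: leq_ltn_trans ltIJ.
  have := hJ J (subxx _) J0; rewrite a0 mul0n leqn0 addn_eq0 => /andP[/eqP c _].
  by rewrite c in ltIJ.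
case: (boolP [exists e in J :\: I, count_indep (e |: I)]).
  by case/exists_inP => e; exists e.
rewrite negb_exists_in => /forall_inP hn.
suff : #|J| <= #|I| by rewrite leqNgt ltIJ.
pose P := [set T | maxset (tight I) T].
have tP T : T \in P -> tight I T by rewrite inE => /maxsetp.
have tI : trivIset P.
  apply/trivIsetP => T T' PT PT'; apply: contraNT.
  rewrite -setI_eq0 => nI; have tU := tightU hI (tP _ PT) (tP _ PT') nI.
  move: PT PT'; rewrite !inE => /maxsetP[_ m] /maxsetP[_ m'].
  by rewrite -(m _ tU (subsetUl _ _)) (m' _ tU (subsetUr _ _)).
have sP : cover P \subset I by apply/bigcupsP => T /tP /and3P[].
pose JT T := [set e in J | ends e \subset vertices_of T].
have sJ : J \subset (\bigcup_(T in P) JT T) :|: (I :\: cover P).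
  apply/subsetP => e eJ; rewrite inE.
  case: (boolP (e \in I)) => eI.
    case: (boolP (e \in cover P)) => eC; last by rewrite inE eC eI orbT.
    apply/orP; left; case/bigcupP: eC => T PT eT.
    by apply/bigcupP; exists T => //; rewrite inE eJ; apply: bigcup_sup.
  have he : count_indep [set e] by apply: count_indepS hJ; rewrite sub1set.
  have nd : ~~ count_indep (e |: I) by apply: hn; rewrite inE eI eJ.
  case: (tight_blocker a0 hI he nd) => T tT sT.
  case: (maxset_exists tT) => T' mT' sTT'.
  apply/orP; left; apply/bigcupP; exists T'; rewrite inE // eJ /=.
  exact: subset_trans sT (vertices_ofS sTT').
apply: leq_trans (subset_leq_card sJ) _.
apply: leq_trans (leq_card_setU _ _) _.
rewrite -(cardsID (cover P) I) (setIidPr sP) leq_add2r.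
move: tI => /eqP <-.
have : #|\bigcup_(T in P) JT T| <= \sum_(T in P) #|JT T|.
  elim/big_rec2: _ => [|T n S _ h]; first by rewrite cards0.
  by apply: leq_trans (leq_card_setU _ _) _; rewrite leq_add2l.
move/leq_trans; apply; apply: leq_sum => T /tP /and3P[_ _ /eqP tT].
case: (eqVneq (JT T) set0) => [->|nJT]; first by rewrite cards0.
rewrite -(leq_add2r b) tT; move/count_indepP: hJ => hJ.
apply: leq_trans (hJ _ _ nJT) _.
  by apply/subsetP => e; rewrite inE => /andP[].
rewrite leq_pmul2l //; apply: subset_leq_card.
by apply/bigcupsP => e; rewrite inE => /andP[].
Qed.

Definition count_matroid : matroid (edge H) :=
  Matroid count_indep0 count_indepS count_indep_aug.

End CountMatroid.

(* Truncated subtraction: a - b is max(a - b, 0).  Pairs of distinct vertices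
   are 2-element vertex sets. *)
Section FullCountMatroid.
Variables (a b n : nat).

Definition K_edge : finType :=
  (('I_n * 'I_(a - b)) + ({A : {set 'I_n} | #|A| == 2} * 'I_(2 * a - b)))%type.

Definition K_ends (e : K_edge) : {set 'I_n} :=
  match e with
  | inl (v, _) => [set v]
  | inr (A, _) => val A
  end.

Lemma card_K_ends e : 0 < #|K_ends e| <= 2.
Proof. by case: e => [[v i]|[[A /= /eqP cA] i]] /=; rewrite ?cards1 ?cA. Qed.

Definition K_graph : multigraph := Multigraph card_K_ends.

Definition full_count_matroid : matroid (edge K_graph) :=
  count_matroid a b K_graph.

End FullCountMatroid.

(* Main.v *)
(* Deleting a series class [A] of a cyclic set [D] lowers the rank by
   [#|A| - 1], and the principal partition of [D] consists of its series
   classes.  So [D] is balanced if intersecting the flats [cl (D :\: A)] one at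
   a time is modular; submodularity gives one inequality.  For the other one,
   use that when [b <= a] the closure of a cyclic set [C] is the union of the
   complete graphs on disjoint vertex sets, its rigid components.  If [C] lies
   between [A] and [D] then [A] lies in one of these graphs, and the others are
   spanned by [D :\: A].  Hence the intersection of such closures consists of
   edges of [cl (D :\: A)] and of the complete graph on the intersection [Z] of
   their components containing [A], and that graph is modular with respect to
   [cl (D :\: A)]. *)
Require Import Defs.
From mathcomp Require Import all_boot zify.

Set Implicit Arguments.
Unset Strict Implicit.
Unset Printing Implicit Defensive.

Lemma setDDK (T : finType) (A D : {set T}) :
  A \subset D -> D :\: (D :\: A) = A.
Proof. by move=> sAD; rewrite setDDr setDv set0U; apply/setIidPr. Qed.

Section Matroid.
Variables (E : finType) (M : matroid E).
Implicit Types (A B C D I J X Y : {set E}) (e x : E) (k : nat).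

Lemma leq_card_rank I X : I \subset X -> indep M I -> #|I| <= rank M X.
Proof. by move=> sI iI; apply: (@leq_bigmax_cond _ _ _ I); rewrite sI. Qed.

Lemma rank_leP X m :
  reflect (forall I, I \subset X -> indep M I -> #|I| <= m) (rank M X <= m).
Proof.
apply: (iffP (bigmax_leqP _ _ _)) => [h I sI iI|h I /andP[]]; last exact: h.
by apply: h; rewrite sI.
Qed.

Lemma rank_le_card X : rank M X <= #|X|.
Proof. by apply/rank_leP => I /subset_leq_card. Qed.

Lemma rank0 : rank M set0 = 0.
Proof. by apply/eqP; rewrite -leqn0 -(@cards0 E) rank_le_card. Qed.

Lemma rankS X Y : X \subset Y -> rank M X <= rank M Y.
Proof.
move=> sXY; apply/rank_leP => I sI; apply: leq_card_rank.
exact: subset_trans sXY.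
Qed.

Definition basis X B := [&& B \subset X, indep M B & #|B| == rank M X].

Lemma indep_extend I X :
  I \subset X -> indep M I -> exists2 B, basis X B & I \subset B.
Proof.
move=> sIX iI; pose P B := (B \subset X) && indep M B.
have [|B /maxsetP[/andP[sB iB] maxB] sIB] := @maxset_exists _ P I.
  by rewrite /P sIX.
exists B => //; rewrite /basis sB iB eqn_leq leq_card_rank //=.
apply/rank_leP => J sJ iJ; rewrite leqNgt; apply/negP.
move=> /(indep_aug iB iJ)[e /setDP[eJ eB] ieB].
have sBe : e |: B \subset X by rewrite subUset sub1set (subsetP sJ).
have := maxB (e |: B); rewrite /P sBe ieB subsetUr => /(_ isT isT) eqB.
by rewrite -eqB setU11 in eB.
Qed.

Lemma basis_exists X : exists B, basis X B.
Proof.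
by have [B hB _] := indep_extend (sub0set X) (indep0 M); exists B.
Qed.

Lemma basis_setU1_dep X B e :
  basis X B -> e \in cl M X -> e \notin B -> ~~ indep M (e |: B).
Proof.
case/and3P=> sB _ /eqP cB; rewrite inE => /eqP re eB; apply/negP=> ieB.
have := leq_card_rank (setUS [set e] sB) ieB.
by rewrite re cardsU1 eB cB ltnn.
Qed.

Lemma rank_submod X Y :
  rank M (X :|: Y) + rank M (X :&: Y) <= rank M X + rank M Y.
Proof.
have [I /and3P[sI iI /eqP <-]] := basis_exists (X :&: Y).
have [|J /and3P[sJ iJ /eqP <-] sIJ] := @indep_extend I (X :|: Y) _ iI.
  by apply: subset_trans sI _; rewrite subIset // subsetUl.
have cardJI Z : #|J :&: Z| <= rank M Z.
  by rewrite leq_card_rank ?subsetIr //; apply: indepS iJ; apply: subsetIl.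
apply: leq_trans (leq_add (cardJI X) (cardJI Y)).
rewrite -(cardsUI (J :&: X)) -setIUr (setIidPl sJ) leq_add2l subset_leq_card //.
by rewrite -setIIr subsetI sIJ sI.
Qed.

Lemma rankU X Y : rank M (X :|: Y) <= rank M X + rank M Y.
Proof. by have := rank_submod X Y; lia. Qed.

Lemma rankID X Y : rank M X <= rank M (X :&: Y) + rank M (X :\: Y).
Proof. by rewrite -{1}(setID X Y) rankU. Qed.

Lemma rank_bigcup (T : Type) (s : seq T) (P : pred T) (F : T -> {set E}) :
  rank M (\bigcup_(i <- s | P i) F i) <= \sum_(i <- s | P i) rank M (F i).
Proof.
elim/big_rec2: _ => [|i m X _ le]; first by rewrite rank0.
by rewrite (leq_trans (rankU _ _)) ?leq_add2l.
Qed.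

Lemma sub_cl X : X \subset cl M X.
Proof. by apply/subsetP=> e eX; rewrite inE (setUidPr _) ?sub1set. Qed.

Lemma rank_setU_cl X Y : Y \subset cl M X -> rank M (X :|: Y) = rank M X.
Proof.
move=> sY; apply/eqP; rewrite eqn_leq (rankS (subsetUl X Y)) andbT.
have [B hB] := basis_exists X; have /and3P[_ iB /eqP <-] := hB.
apply/rank_leP => J sJ iJ; rewrite leqNgt; apply/negP.
move=> /(indep_aug iB iJ)[e /setDP[eJ eB]]; apply/negP.
apply: basis_setU1_dep hB _ eB.
by have /setUP[/(subsetP (sub_cl X))|/(subsetP sY)] := subsetP sJ e eJ.
Qed.

Lemma rank_cl X : rank M (cl M X) = rank M X.
Proof.
by rewrite -(rank_setU_cl (subxx (cl M X))) (setUidPr (sub_cl X)).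
Qed.

Lemma sub_cl_rank X Y :
  X \subset Y -> rank M Y <= rank M X -> Y \subset cl M X.
Proof.
move=> sXY le_rank; apply/subsetP=> e eY.
rewrite inE eqn_leq (rankS (subsetUr [set e] X)) andbT.
by apply: leq_trans le_rank; apply: rankS; rewrite subUset sub1set eY.
Qed.

Lemma clS X Y : X \subset Y -> cl M X \subset cl M Y.
Proof.
move=> sXY; apply: subset_trans (subsetUl _ Y) (sub_cl_rank (subsetUr _ _) _).
have := rank_submod (cl M X) Y; rewrite rank_cl.
have /rankS : X \subset cl M X :&: Y by rewrite subsetI sub_cl.
lia.
Qed.

Lemma mem_cl_setD1 e X :
  e \in X -> (e \in cl M (X :\ e)) = (rank M (X :\ e) == rank M X).
Proof. by move=> eX; rewrite inE setD1K // eq_sym. Qed.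

Lemma cyclic_setP D :
  reflect (forall e, e \in D -> rank M (D :\ e) = rank M D) (cyclic_set M D).
Proof. exact: 'forall_in_eqP. Qed.

Definition nullity X := #|X| - rank M X.

Lemma rank_nullity X : rank M X + nullity X = #|X|.
Proof. exact/subnKC/rank_le_card. Qed.

Lemma nullityS X Y : X \subset Y -> nullity X <= nullity Y.
Proof.
move=> sXY; have := rankID Y X; have := rank_le_card (Y :\: X).
have := cardsID X Y; rewrite (setIidPr sXY).
have := rank_nullity X; have := rank_nullity Y; lia.
Qed.

Lemma nullity_cyclic_setD1 D e :
  cyclic_set M D -> e \in D -> (nullity (D :\ e)).+1 = nullity D.
Proof.
move=> /cyclic_setP cycD eD; have := rank_nullity (D :\ e).
have := rank_nullity D; rewrite (cardsD1 e D) eD cycD //; lia.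
Qed.

Lemma cyclic_eq_nullity X D : cyclic_set M D ->
  X \subset D -> nullity D <= nullity X -> X = D.
Proof.
move=> cycD sXD le_null; apply/eqP; rewrite eqEsubset sXD.
apply/subsetP=> e eD; apply: contraLR le_null => eX.
rewrite -ltnNge -(nullity_cyclic_setD1 cycD eD) ltnS nullityS //.
by rewrite subsetD1 sXD.
Qed.

Lemma kfold_circuitE k D :
  kfold_circuit M k D = cyclic_set M D && (nullity D == k).
Proof. by rewrite /kfold_circuit -rank_nullity eqn_add2l eq_sym. Qed.

Definition cyclic_core X : {set E} :=
  [set x in X | rank M (X :\ x) == rank M X].

Lemma cyclic_core_sub X : cyclic_core X \subset X.
Proof. by apply/subsetP=> x; rewrite inE => /andP[]. Qed.

(* The elements outside the core are coloops, so every basis contains them. *)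
Lemma rank_cyclic_core X :
  rank M (cyclic_core X) + #|X :\: cyclic_core X| = rank M X.
Proof.
have [B hB] := basis_exists (cyclic_core X).
have /and3P[sB iB /eqP cB] := hB.
have [B' hB' sBB'] := indep_extend (subset_trans sB (cyclic_core_sub X)) iB.
have /and3P[sB' iB' /eqP cB'] := hB'.
have coloops : X :\: cyclic_core X \subset B'.
  apply/subsetP=> x /setDP[xX]; rewrite inE xX /=; apply: contraNT => xB'.
  rewrite eqn_leq rankS ?subD1set //= -cB' leq_card_rank //.
  by rewrite subsetD1 sB'.
have := rankID X (cyclic_core X); rewrite (setIidPr (cyclic_core_sub X)).
have := rank_le_card (X :\: cyclic_core X).
have : #|B :|: (X :\: cyclic_core X)| <= #|B'|.
  by rewrite subset_leq_card // subUset sBB'.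
have := cardsUI B (X :\: cyclic_core X).
rewrite setIDA (setIidPl (subset_trans sB (cyclic_core_sub X))).
have -> : B :\: cyclic_core X = set0 by apply/eqP; rewrite setD_eq0.
rewrite cards0; lia.
Qed.

Lemma nullity_cyclic_core X : nullity (cyclic_core X) = nullity X.
Proof.
have := rank_cyclic_core X; have := cardsID (cyclic_core X) X.
rewrite (setIidPr (cyclic_core_sub X)).
have := rank_nullity X; have := rank_nullity (cyclic_core X); lia.
Qed.

Lemma cyclic_core_cyclic X : cyclic_set M (cyclic_core X).
Proof.
apply/cyclic_setP=> x xX; apply/eqP; rewrite eqn_leq rankS ?subD1set //=.
have := rankID (X :\ x) (cyclic_core X :\ x).
rewrite (setIidPr (setSD _ (cyclic_core_sub X))).
have -> : (X :\ x) :\: (cyclic_core X :\ x) = X :\: cyclic_core X.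
  apply/setP=> y; rewrite !inE; case: eqP => // ->.
  by move: xX; rewrite inE => ->.
have := xX; rewrite inE => /andP[_ /eqP ->]; rewrite -rank_cyclic_core.
have := rank_le_card (X :\: cyclic_core X); lia.
Qed.

Lemma sub_cyclic_core C X :
  cyclic_set M C -> C \subset X -> C \subset cyclic_core X.
Proof.
move=> /cyclic_setP cycC sCX; apply/subsetP=> x xC.
have xX := subsetP sCX x xC; rewrite inE xX /= -mem_cl_setD1 //.
by apply: (subsetP (clS (setSD _ sCX))); rewrite mem_cl_setD1 ?cycC.
Qed.

(* For cyclic [D], these are the parallel classes of the dual of [M | D]. *)
Definition series_classes D : {set {set E}} :=
  [set A : {set E} | [&& A \subset D, cyclic_set M (D :\: A)
                       & (nullity (D :\: A)).+1 == nullity D]].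

Lemma principal_partitionE k D : 0 < k -> kfold_circuit M k D ->
  principal_partition M k D = series_classes D.
Proof.
move=> k_gt0; rewrite kfold_circuitE => /andP[_ /eqP nullD].
apply/setP=> A; rewrite inE nullD.
apply/imsetP/and3P => [[B]|[sA cycDA nullDA]].
  rewrite inE kfold_circuitE => /and3P[sB cycB /eqP nullB] ->.
  by rewrite subsetDl setDDK // nullB prednK.
exists (D :\: A); last by rewrite setDDK.
by rewrite inE subsetDl kfold_circuitE cycDA /= -eqSS prednK.
Qed.

Section SeriesClasses.
Variable D : {set E}.

Lemma series_class_sub A : A \in series_classes D -> A \subset D.
Proof. by rewrite inE => /and3P[]. Qed.

Lemma series_class_cyclic A :
  A \in series_classes D -> cyclic_set M (D :\: A).
Proof. by rewrite inE => /and3P[]. Qed.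

Lemma rank_setD_series_class A : A \in series_classes D ->
  rank M (D :\: A) + #|A| = (rank M D).+1.
Proof.
rewrite inE => /and3P[sA _ /eqP nullDA].
have := rank_nullity (D :\: A); have := rank_nullity D.
by have := cardsID A D; rewrite (setIidPr sA); lia.
Qed.

Hypothesis cycD : cyclic_set M D.

Lemma setD_series_class A e : A \in series_classes D -> e \in A ->
  D :\: A = cyclic_core (D :\ e).
Proof.
rewrite inE => /and3P[sA cycDA /eqP nullDA] eA.
apply: cyclic_eq_nullity; first exact: cyclic_core_cyclic.
  by rewrite sub_cyclic_core // subsetD1 subsetDl inE eA.
rewrite nullity_cyclic_core -ltnS nullDA nullity_cyclic_setD1 //.
exact: subsetP sA e eA.
Qed.

Lemma series_classE A e : A \in series_classes D -> e \in A ->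
  A = D :\: cyclic_core (D :\ e).
Proof.
move=> hA eA.
by rewrite -(setD_series_class hA eA) setDDK // series_class_sub.
Qed.

Lemma mem_series_classes e :
  e \in D -> D :\: cyclic_core (D :\ e) \in series_classes D.
Proof.
move=> eD; rewrite inE subsetDl setDDK.
  by rewrite cyclic_core_cyclic nullity_cyclic_core nullity_cyclic_setD1 /=.
exact: subset_trans (cyclic_core_sub _) (subsetDl _ _).
Qed.

Lemma series_classes_partition : partition (series_classes D) D.
Proof.
apply/and3P; split.
- rewrite eqEsubset; apply/andP; split.
    by apply/bigcupsP=> A; apply: series_class_sub.
  apply/subsetP=> e eD; apply/bigcupP.
  exists (D :\: cyclic_core (D :\ e)); first exact: mem_series_classes.
  rewrite inE eD andbT; apply/negP=> /(subsetP (cyclic_core_sub _)).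
  by rewrite setD11.
- apply/trivIsetP=> A A' hA hA'; apply: contraNT.
  rewrite -setI_eq0 => /set0Pn[e /setIP[eA eA']].
  by rewrite (series_classE hA eA) -(series_classE hA' eA').
- by apply/negP=> /rank_setD_series_class; rewrite setD0 cards0; lia.
Qed.

Lemma series_class_neq0 A : A \in series_classes D -> A != set0.
Proof.
have /and3P[_ _ no0] := series_classes_partition.
by apply: contraTneq => ->.
Qed.

Lemma cyclic_setD_setU1 (S : {set {set E}}) B :
  S \subset series_classes D -> B \in set0 |: S -> cyclic_set M (D :\: B).
Proof.
move=> sS /setU1P[->|BS]; first by rewrite setD0.
exact: series_class_cyclic (subsetP sS B BS).
Qed.

Lemma series_class_sub_setD (S : {set {set E}}) A B :
  S \subset series_classes D -> A \in series_classes D -> A \notin S ->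
  B \in set0 |: S -> A \subset D :\: B.
Proof.
move=> sS hA AS; rewrite subsetD (series_class_sub hA) => /setU1P[->|BS].
  by rewrite disjoint_sym disjoints_subset sub0set.
have /and3P[_ /trivIsetP disj _] := series_classes_partition.
apply: disj hA (subsetP sS B BS) _.
by apply: contraNneq AS => ->.
Qed.

Lemma series_class_sub_cyclic A C e : A \in series_classes D ->
  cyclic_set M C -> C \subset D -> e \in A -> e \in C -> A \subset C.
Proof.
move=> hA cycC sCD eA eC; apply/subsetP=> f fA; apply: contraLR eA => fC.
have : e \in cyclic_core (D :\ f).
  by apply: (subsetP (sub_cyclic_core cycC _)) => //; rewrite subsetD1 sCD.
by rewrite -(setD_series_class hA fA) => /setDP[].
Qed.

End SeriesClasses.

Definition cap_cl D (T : {set {set E}}) : {set E} :=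
  \bigcap_(A in T) cl M (D :\: A).

Section Balanced.
Variable D : {set E}.
Hypothesis cycD : cyclic_set M D.
(* The member [set0] contributes the factor [cl M D]. *)
Hypothesis cap_cl_modular : forall (S : {set {set E}}) A,
  S \subset series_classes D -> A \in series_classes D -> A \notin S ->
  rank M (cap_cl D (set0 |: S)) + rank M (D :\: A)
    <= rank M (cl M (D :\: A) :&: cap_cl D (set0 |: S)) + rank M D.

Lemma cap_cl_setU1 (S : {set {set E}}) A :
  A \in series_classes D -> A \notin S ->
  cap_cl D (set0 |: (A |: S)) = cl M (D :\: A) :&: cap_cl D (set0 |: S).
Proof.
move=> hA AS; rewrite /cap_cl setUCA big_setU1 // in_setU1 negb_or AS andbT.
exact: (series_class_neq0 cycD).
Qed.

Lemma rank_cap_cl_setU1 (S : {set {set E}}) A :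
  S \subset series_classes D -> A \in series_classes D -> A \notin S ->
  rank M (cap_cl D (set0 |: (A |: S))) + #|A|
    = (rank M (cap_cl D (set0 |: S))).+1.
Proof.
move=> sS hA AS; apply: (@addIn (rank M D)).
rewrite addSn -addnS -(rank_setD_series_class hA) addnAC addnA cap_cl_setU1 //.
congr (_ + _); apply/eqP; rewrite eqn_leq cap_cl_modular // andbT.
rewrite -(rank_cl (D :\: A)) addnC [leqRHS]addnC.
apply: leq_trans (rank_submod _ _); rewrite leq_add2r rankS //.
rewrite -{1}(setID D A) setUC setUSS //; first exact: sub_cl.
apply/bigcapsP=> B hB; apply: subset_trans (subsetIr _ _) _.
exact: subset_trans (series_class_sub_setD cycD sS hA AS hB) (sub_cl _).
Qed.

Lemma rank_cap_cl (S : {set {set E}}) : S \subset series_classes D ->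
  rank M (cap_cl D (set0 |: S)) + \sum_(A in S) #|A| = rank M D + #|S|.
Proof.
have [m] := ubnP #|S|; elim: m S => // m IH S ltS sS.
have [->|[A AS]] := set_0Vmem S.
  by rewrite setU0 /cap_cl big_set1 setD0 rank_cl big_set0 cards0.
have sS' : S :\ A \subset series_classes D.
  exact: subset_trans (subD1set _ _) sS.
have := rank_cap_cl_setU1 sS' (subsetP sS A AS) (negbT (setD11 A S)).
rewrite setD1K // (big_setD1 A) //= addnA => ->.
by move: ltS; rewrite (cardsD1 A S) AS add1n addSn addnS => /IH->.
Qed.

Lemma modular_balanced k : 0 < k -> kfold_circuit M k D -> balanced M k D.
Proof.
move=> k_gt0 kD.
have [_ /eqP nullD] : cyclic_set M D /\ nullity D == k.
  by apply/andP; rewrite -kfold_circuitE.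
rewrite /balanced principal_partitionE // -/(cap_cl _ _).
have [A hA] : exists A, A \in series_classes D.
  have /card_gt0P[e eD] : 0 < #|D| by rewrite -rank_nullity nullD; lia.
  by exists (D :\: cyclic_core (D :\ e)); apply: mem_series_classes.
have <- : cap_cl D (set0 |: series_classes D) = cap_cl D (series_classes D).
  apply/eqP; rewrite /cap_cl bigcap_setU big_set1 eqEsubset subsetIr /=.
  rewrite subsetI subxx andbT (bigcap_min A) // setD0.
  by apply: clS; apply: subsetDl.
have := rank_cap_cl (subxx _).
rewrite -(card_partition (series_classes_partition cycD)) -rank_nullity nullD.
lia.
Qed.

End Balanced.
End Matroid.

Section CountRank.
Variables (a b : nat) (H : multigraph).
Local Notation M := (count_matroid a b H).
Implicit Types (B C D F I J T : {set edge H}) (X Y Z : {set vertex H}).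
Implicit Types (e f : edge H) (Pi : {set {set vertex H}}).

Definition edges_in Z : {set edge H} := [set e | ends e \subset Z].

(* Truncated subtraction gives [rho set0 = 0], the rank of no edges. *)
Definition rho Z : nat := a * #|Z| - b.

Lemma edges_inI Y Z : edges_in (Y :&: Z) = edges_in Y :&: edges_in Z.
Proof. by apply/setP=> e; rewrite !inE subsetI. Qed.

Lemma edges_inS Y Z : Y \subset Z -> edges_in Y \subset edges_in Z.
Proof.
by move=> sYZ; apply/subsetP=> e; rewrite !inE => /subset_trans; apply.
Qed.

Lemma ends_neq0 e : ends e != set0.
Proof. by have /andP[] := card_ends e; rewrite card_gt0. Qed.

Lemma edges_in0 : edges_in set0 = set0.
Proof.
by apply/setP=> e; rewrite !inE subset0 (negPf (ends_neq0 e)).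
Qed.

Lemma ends_sub_vertices_of e F : e \in F -> ends e \subset vertices_of F.
Proof. exact: bigcup_sup. Qed.

Lemma sub_edges_in F Z : (F \subset edges_in Z) = (vertices_of F \subset Z).
Proof.
by apply/subsetP/bigcupsP=> sF e eF; have := sF e eF; rewrite inE.
Qed.

Lemma vertices_of_neq0 F : F != set0 -> vertices_of F != set0.
Proof.
case/set0Pn=> e eF; have /set0Pn[v ve] := ends_neq0 e; apply/set0Pn; exists v.
exact: subsetP (ends_sub_vertices_of eF) v ve.
Qed.

Lemma disjoint_vertices_of F J :
  [disjoint vertices_of F & vertices_of J] -> [disjoint F & J].
Proof.
rewrite -!setI_eq0; apply: contraTT => /vertices_of_neq0/set0Pn[v].
move=> /bigcupP[e /setIP[eF eJ] ve]; apply/set0Pn; exists v.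
by rewrite inE !(subsetP (ends_sub_vertices_of _) v ve).
Qed.

Lemma rank_edges_in_le Z : rank M (edges_in Z) <= rho Z.
Proof.
apply/rank_leP => I; rewrite sub_edges_in => sIZ /count_indepP iI.
have [->|nI] := eqVneq I set0; first by rewrite cards0.
have := iI I (subxx _) nI.
have := leq_mul (leqnn a) (subset_leq_card sIZ); rewrite /rho; lia.
Qed.

Lemma count_indep_card F :
  (forall e, e \in F -> #|F| + b <= a * #|ends e|) -> count_indep a b F.
Proof.
move=> cardF; apply/count_indepP=> F' sF' /set0Pn[e eF'].
have := cardF e (subsetP sF' e eF'); have := subset_leq_card sF'.
have /(leq_mul (leqnn a)) := subset_leq_card (ends_sub_vertices_of eF').
lia.
Qed.

Lemma count_indep_disjointU I J : count_indep a b I -> count_indep a b J ->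
  [disjoint vertices_of I & vertices_of J] -> count_indep a b (I :|: J).
Proof.
move=> /count_indepP iI /count_indepP iJ dIJ; apply/count_indepP=> F sF nF.
have eF : F = (F :&: I) :|: (F :&: J) by rewrite -setIUr (setIidPl sF).
have [F0|nFI] := eqVneq (F :&: I) set0.
  by apply: iJ => //; rewrite eF F0 set0U subsetIr.
have [F0|nFJ] := eqVneq (F :&: J) set0.
  by apply: iI => //; rewrite eF F0 setU0 subsetIr.
have := iI _ (subsetIr F I) nFI; have := iJ _ (subsetIr F J) nFJ.
have : [disjoint vertices_of (F :&: I) & vertices_of (F :&: J)].
  apply: disjointWl (vertices_ofS (subsetIr F I)) _.
  exact: disjointWr (vertices_ofS (subsetIr F J)) dIJ.
rewrite -leq_card_setU -vertices_ofU -eF => /eqP ->.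
have := cardsUI (F :&: I) (F :&: J); rewrite -eF mulnDr; lia.
Qed.

Lemma rank_disjointU C F : [disjoint vertices_of C & vertices_of F] ->
  rank M (C :|: F) = rank M C + rank M F.
Proof.
move=> dCF; apply/eqP; rewrite eqn_leq rankU /=.
have [I /and3P[sI iI /eqP <-]] := basis_exists M C.
have [J /and3P[sJ iJ /eqP <-]] := basis_exists M F.
have dIJ : [disjoint vertices_of I & vertices_of J].
  exact: disjointWl (vertices_ofS sI) (disjointWr (vertices_ofS sJ) dCF).
have /eqP <- : #|I :|: J| == #|I| + #|J|.
  by rewrite leq_card_setU disjoint_vertices_of.
apply: leq_card_rank; first exact: setUSS.
exact: count_indep_disjointU.
Qed.

Lemma rank_disjoint_bigcup (K : finType) (P : {set K}) (F : K -> {set edge H}) :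
  {in P &, forall i j, i != j ->
     [disjoint vertices_of (F i) & vertices_of (F j)]} ->
  rank M (\bigcup_(i in P) F i) = \sum_(i in P) rank M (F i).
Proof.
have [m] := ubnP #|P|; elim: m P => // m IH P ltP disjF.
have [->|[i iP]] := set_0Vmem P.
  by rewrite !big_set0 rank0.
rewrite !(big_setD1 i iP) /= rank_disjointU ?IH //.
- by move: ltP; rewrite (cardsD1 i) iP.
- by move=> j l /setD1P[_ jP] /setD1P[_ lP]; apply: disjF.
- rewrite (big_morph _ (@vertices_ofU H) (big_set0 _ _ _)).
  apply: bigcup_disjoint => j /setD1P[nji jP].
  by apply: disjF => //; rewrite eq_sym.
Qed.

Section Tight.
Hypotheses (a_gt0 : 0 < a) (le_ba : b <= a).
Hypothesis count_indep_set1 : forall e, count_indep a b [set e].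

Lemma tight_vertexU I T T' : count_indep a b I -> tight a b I T ->
  tight a b I T' -> ~~ [disjoint vertices_of T & vertices_of T'] ->
  tight a b I (T :|: T').
Proof.
move=> iI tT tT' meet.
have [TT'|] := eqVneq (T :&: T') set0; last exact: tightU.
move/count_indepP: iI => iI.
move: tT tT' => /and3P[sT nT /eqP cT] /and3P[sT' _ /eqP cT'].
have sU : T :|: T' \subset I by rewrite subUset sT.
have nU : T :|: T' != set0 by rewrite setU_eq0 negb_and nT.
rewrite /tight sU nU eqn_leq iI //= cardsU TT' cards0 subn0.
have := cardsUI (vertices_of T) (vertices_of T').
rewrite -vertices_ofU => /(congr1 (muln a)); rewrite !mulnDr -cT -cT'.
have : a <= a * #|vertices_of T :&: vertices_of T'|.
  by rewrite leq_pmulr // card_gt0 setI_eq0.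
lia.
Qed.

Lemma tight_setU1_dep I T e : tight a b I T -> ends e \subset vertices_of T ->
  e \notin T -> ~~ count_indep a b (e |: T).
Proof.
move=> /and3P[_ nT /eqP cT] sV eT; apply/negP=> /count_indepP/(_ _ (subxx _)).
rewrite setU_eq0 negb_and nT orbT vertices_ofU {1}/vertices_of big_set1.
by rewrite (setUidPr sV) cardsU1 eT -cT => /(_ isT); rewrite ltnn.
Qed.

Definition tight_components I : {set {set edge H}} :=
  [set T | maxset (tight a b I) T].

Lemma tight_componentP I T : T \in tight_components I -> tight a b I T.
Proof. by rewrite inE => /maxsetp. Qed.

Lemma tight_sub_component I T :
  tight a b I T -> exists2 T', T' \in tight_components I & T \subset T'.
Proof. by move=> /maxset_exists[T' mT' sT']; exists T'; rewrite ?inE. Qed.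

Lemma tight_component_sub I T T' : count_indep a b I ->
  T \in tight_components I -> tight a b I T' ->
  ~~ [disjoint vertices_of T & vertices_of T'] -> T' \subset T.
Proof.
move=> iI hT tT' meet.
have tU := tight_vertexU iI (tight_componentP hT) tT' meet.
move: hT; rewrite inE => /maxsetP[_ /(_ _ tU (subsetUl _ _)) <-].
exact: subsetUr.
Qed.

Lemma disjoint_tight_components I : count_indep a b I ->
  {in tight_components I &, forall T T', T != T' ->
     [disjoint vertices_of T & vertices_of T']}.
Proof.
move=> iI T T' hT hT'; apply: contraNT => meet; rewrite eqEsubset.
rewrite (tight_component_sub iI hT (tight_componentP hT')) //.
by rewrite (tight_component_sub iI hT' (tight_componentP hT)) // disjoint_sym.
Qed.

Lemma trivIset_tight_vertices I : count_indep a b I ->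
  trivIset (@vertices_of H @: tight_components I)
  /\ {in tight_components I &, injective (@vertices_of H)}.
Proof.
move=> iI; apply: trivIimset => [T T' hT hT'|].
  by rewrite eq_sym; apply: (disjoint_tight_components iI).
apply/imsetP=> -[T /tight_componentP/and3P[_ nT _] T0].
by have := vertices_of_neq0 nT; rewrite -T0 eqxx.
Qed.

Lemma sum_rho_tight_components I : count_indep a b I ->
  \sum_(Z in @vertices_of H @: tight_components I) rho Z
    = #|cover (tight_components I)|.
Proof.
move=> iI; have [_ injV] := trivIset_tight_vertices iI.
have /eqP <- : trivIset (tight_components I).
  apply/trivIsetP=> T T' hT hT' ne; apply/disjoint_vertices_of.
  exact: (disjoint_tight_components iI).
rewrite big_imset //; apply: eq_bigr => T /tight_componentP/and3P[_ _ /eqP cT].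
by rewrite /rho -cT addnK.
Qed.

Lemma basis_cl_tight C I e : basis M C I -> e \in cl M C -> e \notin I ->
  exists2 T, tight a b I T & ends e \subset vertices_of T.
Proof.
move=> hI eC eI; have /and3P[_ iI _] := hI.
apply: tight_blocker => //; exact: basis_setU1_dep hI eC eI.
Qed.

Lemma cyclic_basis_tight C I e : cyclic_set M C -> basis M C I -> e \in I ->
  exists2 T, tight a b I T & e \in T.
Proof.
move=> /cyclic_setP cycC hI eI; have /and3P[sI iI /eqP cI] := hI.
have [J /and3P[sJ iJ /eqP cJ]] := basis_exists M (C :\ e).
have iIe : indep M (I :\ e) by apply: indepS iI; apply: subsetDl.
have [|f /setDP[fJ fI] ifI] := indep_aug iIe iJ.
  by rewrite cJ cycC ?(subsetP sI) // -cI [ltnRHS](cardsD1 e I) eI.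
have /setD1P[nfe fC] := subsetP sJ f fJ.
rewrite !inE nfe /= in fI.
have [T tT sT] := basis_cl_tight hI (subsetP (sub_cl M C) f fC) fI.
have /and3P[sTI _ _] := tT; exists T => //; apply/negPn/negP => eT.
have /negP[] := tight_setU1_dep tT sT (contra (subsetP sTI f) fI).
by apply: count_indepS ifI; apply: setUS; rewrite subsetD1 sTI.
Qed.

Record rigid_components C Pi : Prop := {
  rigid_trivIset : trivIset Pi;
  rigid_rank : rank M C = \sum_(Z in Pi) rho Z;
  rigid_cl : cl M C \subset \bigcup_(Z in Pi) edges_in Z
}.

Lemma cyclic_rigid_components C :
  cyclic_set M C -> exists Pi, rigid_components C Pi.
Proof.
move=> cycC; have [I hI] := basis_exists M C; have /and3P[sI iI /eqP cI] := hI.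
exists (@vertices_of H @: tight_components I); split.
- by have [] := trivIset_tight_vertices iI.
- rewrite sum_rho_tight_components // -cI; congr #|pred_of_set _|.
  apply/eqP; rewrite eqEsubset; apply/andP; split; last first.
    by apply/bigcupsP=> T /tight_componentP/and3P[].
  apply/subsetP=> e /(cyclic_basis_tight cycC hI)[T tT eT].
  have [T' hT' /subsetP sT] := tight_sub_component tT.
  by apply/bigcupP; exists T'; rewrite // sT.
- apply/subsetP=> e eC; have [T tT eT] :
      exists2 T, tight a b I T & ends e \subset vertices_of T.
    have [eI|] := boolP (e \in I); last exact: basis_cl_tight hI eC.
    have [T tT eT] := cyclic_basis_tight cycC hI eI.
    by exists T; rewrite ?ends_sub_vertices_of.
  have [T' hT' sT] := tight_sub_component tT.
  apply/bigcupP; exists (vertices_of T'); first exact: imset_f.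
  by rewrite inE (subset_trans eT) ?vertices_ofS.
Qed.

Lemma tight_pairs_cover I Z : count_indep a b I -> 1 < #|Z| ->
  {in Z &, forall u v, u != v ->
     exists2 T, tight a b I T & [set u; v] \subset vertices_of T} ->
  exists2 T, tight a b I T & Z \subset vertices_of T.
Proof.
move=> iI /card_gt1P[u [v [uZ vZ nuv]]] pairs.
have [T tT] := pairs u v uZ vZ nuv; have [T' hT' sT] := tight_sub_component tT.
rewrite subUset !sub1set => /andP[uT _].
have uT' := subsetP (vertices_ofS sT) u uT.
exists T'; first exact: tight_componentP.
apply/subsetP=> w wZ; have [<- //|nuw] := eqVneq u w.
have [T'' tT''] := pairs u w uZ wZ nuw.
rewrite subUset !sub1set => /andP[uT'' wT''].
suff sT'' : T'' \subset T' by apply: (subsetP (vertices_ofS sT'')).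
apply: tight_component_sub iI hT' tT'' _.
by apply/pred0Pn; exists u; rewrite /= uT'.
Qed.

End Tight.

Section RigidComponents.
Variables (C : {set edge H}) (Pi : {set {set vertex H}}).
Hypothesis rigidC : rigid_components C Pi.

Lemma rigid_sub : C \subset \bigcup_(Z in Pi) edges_in Z.
Proof. exact: subset_trans (sub_cl M C) (rigid_cl rigidC). Qed.

Lemma rank_setD_component Z :
  Z \in Pi -> rank M (C :\: edges_in Z) + rho Z <= rank M C.
Proof.
move=> PZ; rewrite (rigid_rank rigidC) (bigD1 Z) //= addnC leq_add2l.
apply: leq_trans (leq_sum _ (fun Y _ => rank_edges_in_le Y)).
apply: leq_trans (rank_bigcup _ _ _ _); apply: rankS.
apply/subsetP=> e /setDP[/(subsetP rigid_sub)/bigcupP[Y PY eY] eZ].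
apply/bigcupP; exists Y => //.
by rewrite PY; apply: contraNneq eZ => <-.
Qed.

Lemma rank_setI_component Z :
  Z \in Pi -> rank M (C :&: edges_in Z) = rho Z.
Proof.
move=> PZ; apply/eqP; rewrite eqn_leq.
rewrite (leq_trans (rankS _ (subsetIr _ _)) (rank_edges_in_le Z)) /=.
have := rank_setD_component PZ; have := rankID M C (edges_in Z); lia.
Qed.

Lemma component_sub_cl Z F : Z \in Pi -> C :&: edges_in Z \subset F ->
  edges_in Z \subset cl M F.
Proof.
move=> PZ sF; apply: subset_trans (clS M sF).
apply: sub_cl_rank; first exact: subsetIr.
by rewrite rank_setI_component ?rank_edges_in_le.
Qed.

Lemma cyclic_setI_component Z :
  Z \in Pi -> cyclic_set M C -> cyclic_set M (C :&: edges_in Z).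
Proof.
move=> PZ /cyclic_setP cycC; apply/cyclic_setP=> e /setIP[eC eZ].
apply/eqP; rewrite eqn_leq rankS ?subD1set //= rank_setI_component //.
have := rankID M (C :\ e) (edges_in Z); rewrite cycC // setIDAC.
have := rank_setD_component PZ.
have : rank M ((C :\ e) :\: edges_in Z) <= rank M (C :\: edges_in Z).
  by rewrite rankS // setSD ?subD1set.
lia.
Qed.

(* The components not containing the series class [A] are spanned by edges
   of [D :\: A]. *)
Lemma series_class_component D A : cyclic_set M C -> C \subset D ->
  cyclic_set M D -> A \in series_classes M D -> A \subset C ->
  exists Z, [/\ Z \in Pi, edges_in Z \subset cl M C
              & cl M C \subset cl M (D :\: A) :|: edges_in Z].
Proof.
move=> cycC sCD cycD hA sAC; have /set0Pn[e eA] := series_class_neq0 cycD hA.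
have eC := subsetP sAC e eA.
have /bigcupP[Z PZ eZ] := subsetP rigid_sub e eC.
have sAZ : A \subset C :&: edges_in Z.
  apply: (series_class_sub_cyclic cycD hA (cyclic_setI_component PZ cycC) _ eA).
    by apply: subset_trans sCD; apply: subsetIl.
  by rewrite inE eC.
exists Z; split=> //; first exact: component_sub_cl (subsetIl _ _).
apply: subset_trans (rigid_cl rigidC) _; apply/bigcupsP=> Y PY.
have [->|nYZ] := eqVneq Y Z; first exact: subsetUr.
apply: subset_trans (subsetUl _ _); apply: component_sub_cl => //.
rewrite subsetD (subset_trans (subsetIl _ _) sCD) /=.
apply: disjointWl (subsetIr _ _) _; apply: disjointWr sAZ _.
apply: disjointWr (subsetIr _ _) _; rewrite -setI_eq0 -edges_inI.
have /trivIsetP/(_ _ _ PY PZ nYZ) := rigid_trivIset rigidC.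
by rewrite -setI_eq0 => /eqP->; rewrite edges_in0.
Qed.

End RigidComponents.

Lemma leq_sum_rho_setI Pi X Z :
  b <= a -> trivIset Pi -> Z \subset X -> Z != set0 ->
  \sum_(Y in Pi) rho (Y :&: X) + rho Z <= \sum_(Y in Pi) rho (Y :&: Z) + rho X.
Proof.
move=> le_ba trivPi sZX nZ.
have rhoX : rho X = rho Z + a * #|X :\: Z|.
  have := cardsID Z X; rewrite (setIidPr sZX) /rho => <-.
  have : a <= a * #|Z| by rewrite leq_pmulr // card_gt0.
  by rewrite mulnDr; lia.
have rhoI Y : rho (Y :&: X) <= rho (Y :&: Z) + a * #|Y :&: (X :\: Z)|.
  have := cardsID Z (Y :&: X); rewrite -setIA (setIidPr sZX) -setIDA /rho => <-.
  by rewrite mulnDr; lia.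
rewrite rhoX addnCA addnC leq_add2l.
apply: leq_trans (leq_sum _ (fun Y _ => rhoI Y)) _.
rewrite big_split leq_add2l -big_distrr leq_mul2l; apply/orP; right.
under eq_bigr => Y _.
  rewrite -sum1_card (eq_bigl _ _ (fun v => in_setI v Y _)); over.
rewrite -(big_trivIset_cond _ trivPi) sum1_card subset_leq_card //.
by apply/subsetP=> v /andP[].
Qed.

Section Saturated.
Hypothesis le_ba : b <= a.
Hypothesis rank_edges_in : forall Z, rank M (edges_in Z) = rho Z.

Lemma rank_edges_in_cl_modular D C X Z PiD PiC : rigid_components D PiD ->
  rigid_components C PiC -> C \subset D -> X \in PiD -> Z \subset X ->
  rank M (edges_in Z) + rank M C <= rank M (cl M C :&: edges_in Z) + rank M D.
Proof.
move=> rigidD rigidC sCD PX sZX.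
have [->|nZ] := eqVneq Z set0.
  by rewrite edges_in0 setI0 leq_add2l rankS.
have trivC := rigid_trivIset rigidC.
have rankCX : rank M (C :&: edges_in X) <= \sum_(Y in PiC) rho (Y :&: X).
  apply: leq_trans (leq_sum _ (fun Y _ => rank_edges_in_le (Y :&: X))).
  apply: leq_trans (rank_bigcup _ _ _ _); apply: rankS.
  apply/subsetP=> e /setIP[/(subsetP (rigid_sub rigidC))/bigcupP[Y PY eY] eX].
  by apply/bigcupP; exists Y; rewrite // edges_inI inE eY.
have rankCZ : \sum_(Y in PiC) rho (Y :&: Z) <= rank M (cl M C :&: edges_in Z).
  under eq_bigr => Y _ do rewrite -rank_edges_in.
  rewrite -rank_disjoint_bigcup; last first.
    move=> Y Y' PY PY' nYY'.
    apply: disjointWl (_ : _ \subset Y) (disjointWr (_ : _ \subset Y') _).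
    - by rewrite -sub_edges_in edges_inS ?subsetIl.
    - by rewrite -sub_edges_in edges_inS ?subsetIl.
    - exact: (trivIsetP trivC).
  apply: rankS; apply/bigcupsP=> Y PY; rewrite edges_inI setSI //.
  by apply: (component_sub_cl rigidC PY); apply: subsetIl.
have := leq_sum_rho_setI le_ba trivC sZX nZ.
have := rank_setD_component rigidD PX; have := rankID M C (edges_in X).
have := rankS M (setSD (edges_in X) sCD); rewrite rank_edges_in; lia.
Qed.

Hypothesis a_gt0 : 0 < a.
Hypothesis count_indep_set1 : forall e, count_indep a b [set e].

Lemma rank_cap_cl_modular D (S : {set {set edge H}}) A : cyclic_set M D ->
  S \subset series_classes M D -> A \in series_classes M D -> A \notin S ->
  rank M (cap_cl M D (set0 |: S)) + rank M (D :\: A)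
    <= rank M (cl M (D :\: A) :&: cap_cl M D (set0 |: S)) + rank M D.
Proof.
move=> cycD sS hA AS; set G := cap_cl _ _ _; set F := cl M (D :\: A).
have /fin_all_exists[P hP] B : exists Z, B \in set0 |: S ->
    exists2 Pi, rigid_components (D :\: B) Pi
      & [/\ Z \in Pi, edges_in Z \subset cl M (D :\: B)
           & cl M (D :\: B) \subset F :|: edges_in Z].
  have [hB|] := boolP (B \in set0 |: S); last by exists set0.
  have cycDB := cyclic_setD_setU1 cycD sS hB.
  have [Pi rigidDB] :=
    cyclic_rigid_components a_gt0 le_ba count_indep_set1 cycDB.
  have [Z hZ] := series_class_component rigidDB cycDB (subsetDl _ _)
    cycD hA (series_class_sub_setD cycD sS hA AS hB).
  by exists Z => _; exists Pi.
pose Z := \bigcap_(B in set0 |: S) P B.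
have sZG : edges_in Z \subset G.
  apply/bigcapsP=> B hB; have [Pi _ [_ sP _]] := hP B hB.
  by apply: subset_trans sP; apply/edges_inS/bigcap_inf.
have sGF : G \subset (F :&: G) :|: edges_in Z.
  apply/subsetP=> e eG; rewrite in_setU in_setI eG andbT.
  have [//|eF /=] := boolP (e \in F).
  rewrite inE; apply/bigcapsP=> B hB; have [Pi _ [_ _ sDB]] := hP B hB.
  have := subsetP sDB e (bigcapP eG B hB).
  by rewrite in_setU (negPf eF) inE.
have [PiD] := hP set0 (setU11 _ _); rewrite setD0 => rigidD [PX _ _].
have [PiA rigidA] :=
  cyclic_rigid_components a_gt0 le_ba count_indep_set1 (series_class_cyclic hA).
have sZX : Z \subset P set0 by apply: bigcap_inf; apply: setU11.
have := rank_edges_in_cl_modular rigidD rigidA (subsetDl D A) PX sZX.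
have := rank_submod M (F :&: G) (edges_in Z).
rewrite -setIA (setIidPr sZG); have := rankS M sGF; rewrite -/F; lia.
Qed.

Lemma count_kfold_circuit_property k : 0 < k -> kfold_circuit_property M k.
Proof.
move=> k_gt0 D kD; have /andP[cycD _] := kD.
apply: (modular_balanced cycD) => // S A sS hA AS.
exact: rank_cap_cl_modular.
Qed.

End Saturated.
End CountRank.

Section FullCount.
Variables (a b n : nat).
Hypotheses (a_gt0 : 0 < a) (le_ba : b <= a).
Local Notation H := (K_graph a b n).
Local Notation M := (count_matroid a b H).
Implicit Types (I : {set edge H}) (Z : {set vertex H}).
Implicit Types (e : edge H) (u v : vertex H).

Lemma full_count_indep_set1 e : count_indep a b [set e].
Proof.
apply: count_indep_card => f /set1P ->; rewrite cards1.
case: e => [[v i]|[[B /= /eqP ->] i]] /=; last by have := ltn_ord i; lia.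
by rewrite cards1; have := ltn_ord i; lia.
Qed.

Lemma exists_loops_at v :
  exists L : {set edge H}, #|L| = a - b /\ {in L, forall e, ends e = [set v]}.
Proof.
exists [set (inl (v, i) : edge H) | i : 'I_(a - b)].
by split=> [|_ /imsetP[i _ ->] //]; rewrite card_imset ?card_ord // => i j [].
Qed.

Lemma exists_parallel_class u v : u != v ->
  exists N : {set edge H},
    #|N| = 2 * a - b /\ {in N, forall e, ends e = [set u; v]}.
Proof.
move=> nuv; have card_uv : #|[set u; v]| == 2 by rewrite cards2 nuv.
exists [set (inr (exist _ [set u; v] card_uv, i) : edge H)
       | i : 'I_(2 * a - b)].
by split=> [|_ /imsetP[i _ ->] //]; rewrite card_imset ?card_ord // => i j [].
Qed.

Lemma basis_tight_pair Z I u v : basis M (edges_in Z) I ->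
  u \in Z -> v \in Z -> u != v ->
  exists2 T, tight a b I T & [set u; v] \subset vertices_of T.
Proof.
move=> hI uZ vZ nuv; have [N [cardN endsN]] := exists_parallel_class nuv.
have [sNI|/subsetPn[e eN eI]] := boolP (N \subset I); last first.
  rewrite -(endsN e eN).
  apply: (basis_cl_tight a_gt0 full_count_indep_set1 hI _ eI).
  by apply: (subsetP (sub_cl M _)); rewrite inE endsN // subUset !sub1set uZ.
have [e eN] : exists e, e \in N by apply/card_gt0P; rewrite cardN; lia.
have verticesN : vertices_of N = [set u; v].
  apply/eqP; rewrite eqEsubset -{2}(endsN e eN) ends_sub_vertices_of // andbT.
  by apply/bigcupsP=> f /endsN->.
exists N; last by rewrite verticesN.
rewrite /tight sNI verticesN cards2 nuv cardN /=.
by apply/andP; split; [apply/set0Pn; exists e | lia].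
Qed.

Lemma full_rank_edges_in Z : rank M (edges_in Z) = rho a b Z.
Proof.
apply/eqP; rewrite eqn_leq rank_edges_in_le /=.
have [Z_gt1|] := ltnP 1 #|Z|.
  have [I hI] := basis_exists M (edges_in Z); have /and3P[_ iI /eqP <-] := hI.
  have [T /and3P[sTI _ /eqP cardT] sZT] := tight_pairs_cover a_gt0 le_ba iI
    Z_gt1 (fun u v => @basis_tight_pair Z I u v hI).
  have := subset_leq_card sTI; have := leq_mul (leqnn a) (subset_leq_card sZT).
  rewrite /rho; lia.
rewrite leq_eqVlt ltnS leqn0 => /orP[/cards1P[v ->]|]; last first.
  by rewrite cards_eq0 => /eqP->; rewrite /rho cards0; lia.
have [L [cardL endsL]] := exists_loops_at v.
rewrite /rho cards1 muln1 -cardL; apply: leq_card_rank.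
  by apply/subsetP=> e /endsL; rewrite inE => ->.
by apply: count_indep_card => e /endsL->; rewrite cardL cards1; lia.
Qed.

End FullCount.

Theorem mainTheorem5 (a b n k : nat) (hb : 1 <= b) (hba : b <= a)
    (hn : 0 < n) (hk : 1 <= k) :
  kfold_circuit_property (full_count_matroid a b n) k.
Proof.
have a_gt0 := leq_trans hb hba; apply: count_kfold_circuit_property => //.
- exact: full_rank_edges_in.
- exact: full_count_indep_set1.
Qed.
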